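(* For every $\epsilon>0$ there is a quantum algorithm that, given (oracle access to) a graph $G$ on $n$ vertices with maximum degree $\Delta$, outputs a proper $(1+\epsilon)\Delta$-coloring of $G$ with probability at least $2/3$, using $O(\epsilon^{-2}n\log^2 n\sqrt{\Delta})$ quantum neighborhood queries.
   Context: A proper $k$-coloring of a graph $G=(V,E)$ is a map $c$ from $V$ to a set of $k$ colors with $c(u)\neq c(v)$ for every edge $\{u,v\}\in E$. For $v\in V$ and $1\le j\le\Delta$, let $f(v,j)$ be the $j$-th neighbor of $v$ (in an arbitrary but fixed ordering of its neighbors) if it exists and $0$ otherwise. A quantum neighborhood query is one application of the unitary $\mathcal{O}_N$ on $\mathbb{C}^V\otimes\mathbb{C}^{[n]}\otimes\mathbb{C}^{V\cup\{0\}}$ given by $\mathcal{O}_N|v,j,u\rangle=|v,j,u\oplus f(v,j)\rangle$. The algorithm may additionally use classical degree queries ($d(v)$) and classical neighborhood queries; the stated bound counts applications of $\mathcal{O}_N$. *)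

(* Defs.v *)
From mathcomp Require Import all_boot all_order all_algebra.
From mathcomp Require Import reals exp.
From mathcomp Require Import complex.

Set Implicit Arguments.
Unset Strict Implicit.
Unset Printing Implicit Defensive.

Import Order.TTheory GRing.Theory Num.Theory.

Local Open Scope ring_scope.

Record sgraph (n : nat) := SGraph {
  edge : rel 'I_n;
  edge_sym : symmetric edge;
  edge_irr : irreflexive edge
}.

Definition degree n (G : sgraph n) (v : 'I_n) : nat := #|[set u | edge G v u]|.

Definition max_degree n (G : sgraph n) : nat := (\max_(v < n) degree G v)%N.

Definition proper_coloring n (G : sgraph n) (k : nat) (c : {ffun 'I_n -> nat}) :
    bool :=
  [forall v, c v < k]%N && [forall u, forall v, edge G u v ==> (c u != c v)].

(* [nbr v] lists the neighbors of v, each exactly once, in some order. *)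
Definition neighbor_ordering n (G : sgraph n) (nbr : 'I_n -> seq 'I_n) : Prop :=
  forall v, uniq (nbr v) /\ (nbr v =i edge G v).

(* V u {0} is encoded as 'I_n.+1: 0 is ord0 and the vertex u is
   [lift ord0 u], of value u.+1.  Positions are numbered from 0, so that
   j : 'I_n stands for the (j+1)-st position. *)
Definition neighbor_at n (nbr : 'I_n -> seq 'I_n) (v j : 'I_n) : 'I_n.+1 :=
  nth ord0 [seq lift ord0 u | u <- nbr v] j.

(* The state space C^V (x) C^[n] (x) C^(V u {0}) (x) C^w, where C^w is the
   private workspace of an algorithm: column vectors indexed by the basis
   labels |v, j, u, z>, through the enumeration of that finite type. *)

Notation basis n w := ('I_n * 'I_n * 'I_n.+1 * 'I_w)%type.
Notation dimH n w := #|{: basis n w}|.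
Notation state R n w := 'cV[R[i]]_(dimH n w).

(* |v, j, u, z> |-> |v, j, u (+) f(v,j), z>, where (+) is addition modulo n+1
   on V u {0} = 'I_n.+1. *)
Definition neighbor_shift n w (nbr : 'I_n -> seq 'I_n) (b : basis n w) :
    basis n w :=
  let: (v, j, u, z) := b in (v, j, u + neighbor_at nbr v j, z).

Definition neighbor_oracle (R : realType) n w (nbr : 'I_n -> seq 'I_n) :
    'M[R[i]]_(dimH n w) :=
  \matrix_(a, b) (enum_val a == neighbor_shift nbr (enum_val b))%:R.

(* All registers in their first basis state. *)
Definition init_state (R : realType) n w : state R n w :=
  \col_a (let: (v, j, u, z) := enum_val a in
          [&& val v == 0, val j == 0, val u == 0 & val z == 0]%N)%:R.

Definition sqnorm (R : realType) n w (psi : state R n w) : R :=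
  \sum_a ComplexField.Normc.normc (psi a ord0) ^+ 2.

(* Unnormalized post-measurement state when measuring [m] yields [x]. *)
Definition collapse (R : realType) n w q (m : basis n w -> 'I_q) (x : 'I_q)
    (psi : state R n w) : state R n w :=
  \col_a (if m (enum_val a) == x then psi a ord0 else 0).

(* Quantum query programs with classical control.  [Measure m k] measures the
   function m of the basis label and continues with k x on outcome x; this is
   also the only source of randomness. *)
Inductive qprog (R : realType) (n w : nat) : Type :=
| Output of {ffun 'I_n -> nat}
| Apply (U : 'M[R[i]]_(dimH n w)) of U \is unitarymx & qprog R n w
| QuantumQuery of qprog R n w
| Measure q (m : basis n w -> 'I_q) of 'I_q -> qprog R n w
| DegreeQuery (v : 'I_n) of nat -> qprog R n w
| NeighborQuery (v j : 'I_n) of 'I_n.+1 -> qprog R n w.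

Section Semantics.
Variables (R : realType) (n w : nat) (G : sgraph n) (nbr : 'I_n -> seq 'I_n).

(* On an unnormalized state psi this is the sum, over the branches whose output
   satisfies S, of the squared norm of the final state of the branch. *)
Fixpoint prob_from (S : pred {ffun 'I_n -> nat}) (p : qprog R n w)
    (psi : state R n w) : R :=
  match p with
  | Output c => if S c then sqnorm psi else 0
  | Apply U _ p' => prob_from S p' (U *m psi)
  | QuantumQuery p' => prob_from S p' (neighbor_oracle R w nbr *m psi)
  | Measure q m k => \sum_(x < q) prob_from S (k x) (collapse m x psi)
  | DegreeQuery v k => prob_from S (k (degree G v)) psi
  | NeighborQuery v j k => prob_from S (k (neighbor_at nbr v j)) psi
  end.

(* Worst case, over all measurement outcomes, of the number of applications of
   the neighborhood oracle.  A classical neighborhood query is charged as one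
   application (to a basis state): if it were free, reading the whole graph
   would cost nothing.  Degree queries are not counted. *)
Fixpoint neighbor_queries (p : qprog R n w) : nat :=
  match p with
  | Output _ => 0
  | Apply _ _ p' => neighbor_queries p'
  | QuantumQuery p' => (neighbor_queries p').+1
  | Measure q _ k => \max_(x < q) neighbor_queries (k x)
  | DegreeQuery v k => neighbor_queries (k (degree G v))
  | NeighborQuery v j k => (neighbor_queries (k (neighbor_at nbr v j))).+1
  end.

End Semantics.

Record qalgorithm (R : realType) (n : nat) := QAlgorithm {
  workspace : nat;
  program : qprog R n workspace
}.

Definition success_prob (R : realType) n (A : qalgorithm R n) (G : sgraph n)
    (nbr : 'I_n -> seq 'I_n) (S : pred {ffun 'I_n -> nat}) : R :=
  prob_from G nbr S (program A) (init_state R n (workspace A)).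

Definition query_count (R : realType) n (A : qalgorithm R n) (G : sgraph n)
    (nbr : 'I_n -> seq 'I_n) : nat :=
  neighbor_queries G nbr (program A).

(* Rounded up, since rounding down would ask for Delta colors when
   eps * Delta < 1, which is impossible on a complete graph. *)
Definition palette_size (R : realType) n (eps : R) (G : sgraph n) : nat :=
  `|Num.ceil ((1 + eps) * (max_degree G)%:R)|%N.

(* Main.v *)
(* The vertices are colored one after the other.  For a vertex v a uniformly
   random color is drawn, and it is kept unless a quantum search finds a
   neighbor of v which already has it; as at most a fraction 1/(1+eps) of the
   palette is blocked, O(eps^-1 log n) draws suffice.  The search is amplitude
   amplification in its recursive form: A_(k+1) = A_k R_0 A_k^* S A_k, where S
   flips the sign of the marked labels and R_0 that of the initial state, turns
   the success probability p into p (4 p - 3)^2.  So p / (1 - p) grows at least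
   ninefold per level while p < 1/4, and log_9 Delta levels, at a total cost
   O(sqrt Delta), contain one with p >= 1/4 as soon as some label is marked.
   Every find is verified by one query: only overlooked conflicts are errors,
   and repeating the search O(log n + 1/eps) times makes them rare. *)

Require Import Defs.
From mathcomp Require Import all_boot all_order all_algebra.
From mathcomp Require Import reals exp complex ring lra zify.

Set Implicit Arguments.
Unset Strict Implicit.
Unset Printing Implicit Defensive.

Import Order.TTheory GRing.Theory Num.Theory.

Local Open Scope ring_scope.
Local Open Scope sesquilinear_scope.

(** * Householder reflections of a complex column space *)

Section Reflections.
Variables (C : numClosedFieldType) (d : nat).
Implicit Types (u v : 'cV[C]_d) (M : 'M[C]_d).

Definition inner u v : C := (u^t* *m v) ord0 ord0.

Lemma innerE u v : inner u v = \sum_a (u a ord0)^* * v a ord0.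
Proof. by rewrite /inner mxE; apply: eq_bigr => a _; rewrite !mxE. Qed.

Lemma mulmx_inner u v : u^t* *m v = (inner u v)%:M.
Proof. exact: mx11_scalar. Qed.

Lemma adjM m n p (A : 'M[C]_(m, n)) (B : 'M_(n, p)) :
  (A *m B)^t* = B^t* *m A^t*.
Proof. by rewrite trmx_mul map_mxM. Qed.

Lemma inner_adj M u v : inner (M *m u) v = inner u (M^t* *m v).
Proof. by rewrite /inner adjM mulmxA. Qed.

Lemma conj_inner u v : (inner u v)^* = inner v u.
Proof.
rewrite !innerE rmorph_sum; apply: eq_bigr => a _.
by rewrite rmorphM /= conjCK mulrC.
Qed.

Lemma innerBl u u' v : inner (u - u') v = inner u v - inner u' v.
Proof. by rewrite /inner raddfB /= map_mxB mulmxBl !mxE. Qed.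

Lemma innerBr u v v' : inner u (v - v') = inner u v - inner u v'.
Proof. by rewrite /inner mulmxBr !mxE. Qed.

(** The reflection in the hyperplane orthogonal to [v]. For [v = 0] the inverse of [inner v v] is 0,
    so this is the identity and stays unitary without a side condition. *)
Definition refl v : 'M[C]_d := 1%:M - (2 / inner v v) *: (v *m v^t*).

Lemma adj_refl v : (refl v)^t* = refl v.
Proof.
rewrite /refl raddfB /= map_mxB trmx1 map_mx1; congr (_ - _).
rewrite linearZ /= map_mxZ adjM trmxCK.
by rewrite rmorphM /= fmorphV /= conj_inner rmorph_nat.
Qed.

Lemma refl_mulv v u : refl v *m u = u - (2 / inner v v * inner v u) *: v.
Proof.
rewrite /refl mulmxBl mul1mx -scalemxAl -mulmxA mulmx_inner.
by rewrite mul_mx_scalar scalerA.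
Qed.

Lemma inner_eq0 v : (inner v v == 0) = (v == 0).
Proof.
apply/eqP/eqP => [|->]; last by rewrite /inner mulmx0 mxE.
rewrite innerE => h; apply/colP => a; rewrite mxE.
have /psumr_eq0P : forall b, true -> 0 <= (v b ord0)^* * v b ord0.
  by move=> b _; rewrite mulrC mul_conjC_ge0.
move=> /(_ h a isT) /eqP; rewrite mulf_eq0 conjC_eq0 orbb.
by move/eqP.
Qed.

Lemma refl_invol v : refl v *m refl v = 1%:M.
Proof.
have [->|v0] := eqVneq v 0.
  by rewrite /refl mul0mx scaler0 subr0 mulmx1.
have n0 : inner v v != 0 by rewrite inner_eq0.
rewrite {2}/refl mulmxBr mulmx1 -scalemxAr mulmxA refl_mulv divfK //.
rewrite mulmxBl -scalemxAl scalerBr.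
set W := v *m _; rewrite /refl -/W scalerA opprB.
have -> : 2 / inner v v * 2 = 2 / inner v v + 2 / inner v v by ring.
by rewrite scalerDl addrK subrK.
Qed.

Lemma refl_unitary v : refl v \is unitarymx.
Proof. by apply/unitarymxP; rewrite adj_refl refl_invol. Qed.

(** Equal norms and a real inner product give [inner (u - v) (u - v) = 2 * inner (u - v) u], so the
    reflection subtracts exactly [u - v] from [u]. State preparations and resets below are such
    reflections. *)
Lemma refl_swap u v :
  inner u u = inner v v -> inner u v = inner v u -> refl (u - v) *m u = v.
Proof.
move=> uv sym; have [->|uv0] := eqVneq u v.
  by rewrite refl_mulv subrr scaler0 subr0.
rewrite refl_mulv.
suff -> : 2 / inner (u - v) (u - v) * inner (u - v) u = 1.
  by rewrite scale1r subKr.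
have n0 : inner (u - v) (u - v) != 0 by rewrite inner_eq0 subr_eq0.
have E : inner (u - v) (u - v) = 2 * inner (u - v) u.
  by rewrite !(innerBl, innerBr) sym uv; ring.
by rewrite mulrAC -E divff.
Qed.

End Reflections.

(** * The squared modulus of a complex number *)

Section SquaredModulus.
Variable R : realType.
Implicit Types z : R[i].

Definition sqmod z : R := ComplexField.Normc.normc z ^+ 2.

Lemma sqmodC z : ((sqmod z)%:C)%C = z^* * z.
Proof. by rewrite mulrC -normCK rmorphXn. Qed.

Lemma sqmodM z z' : sqmod (z * z') = sqmod z * sqmod z'.
Proof. by rewrite /sqmod ComplexField.Normc.normcM exprMn. Qed.

Lemma sqmod_real (x : R) : sqmod (x%:C)%C = x ^+ 2.
Proof. by rewrite /sqmod /= expr0n addr0 sqrtr_sqr real_normK ?num_real. Qed.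

Lemma sqmod0 : sqmod 0 = 0.
Proof. by rewrite -[0](rmorph0 (real_complex R)) sqmod_real expr0n. Qed.

Lemma sqmod_ge0 z : 0 <= sqmod z.
Proof. exact: sqr_ge0. Qed.

End SquaredModulus.

(** * Uniform superpositions and their preparation from a basis state *)

Section Uniform.
Variables (R : realType) (d : nat).
Implicit Types (B : {set 'I_d}) (psi : 'cV[R[i]]_d).

Definition ket (a : 'I_d) : 'cV[R[i]]_d := delta_mx a ord0.

Lemma inner_ketl a psi : inner (ket a) psi = psi a ord0.
Proof.
rewrite innerE (bigD1 a) //= !mxE !eqxx /= conjC1 mul1r big1 ?addr0 // => b ba.
by rewrite !mxE (negPf ba) conjC0 mul0r.
Qed.

Lemma inner_ketr a psi : inner psi (ket a) = (psi a ord0)^*.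
Proof. by rewrite -inner_ketl conj_inner. Qed.

Lemma inner_sqmod psi : inner psi psi = ((\sum_a sqmod (psi a ord0))%:C)%C.
Proof.
by rewrite innerE rmorph_sum; apply: eq_bigr => a _; rewrite /= sqmodC.
Qed.

Definition unif B : 'cV[R[i]]_d :=
  \col_a (if a \in B then (((Num.sqrt #|B|%:R)^-1 : R)%:C)%C else 0).

Lemma sqmod_unif B a :
  sqmod (unif B a ord0) = if a \in B then #|B|%:R^-1 else 0.
Proof.
rewrite mxE; case: ifP => _; last exact: sqmod0.
by rewrite sqmod_real exprVn sqr_sqrtr ?ler0n.
Qed.

Lemma inner_unif B : (0 < #|B|)%N -> inner (unif B) (unif B) = 1.
Proof.
move=> B0; rewrite inner_sqmod; under eq_bigr do rewrite sqmod_unif.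
rewrite -big_mkcond /= sumr_const -[X in X *+ _]mulr1 -mulrnAr.
rewrite mulVf ?rmorph1 //.
by rewrite pnatr_eq0 -lt0n.
Qed.

Lemma unif_real B a : (unif B a ord0)^* = unif B a ord0.
Proof.
rewrite mxE; case: ifP => _; last exact: conjC0.
by apply/CrealP; apply/complex_realP; eexists.
Qed.

Lemma refl_ket_unif B a : (0 < #|B|)%N ->
  refl (ket a - unif B) *m ket a = unif B.
Proof.
move=> B0; apply: refl_swap.
  by rewrite inner_unif // inner_ketl mxE !eqxx.
by rewrite inner_ketl inner_ketr unif_real.
Qed.

Lemma refl_ket_ket a b : refl (ket a - ket b) *m ket a = ket b.
Proof.
apply: refl_swap; first by rewrite !inner_ketl !mxE !eqxx.
by rewrite !inner_ketl !mxE [b == a]eq_sym.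
Qed.

End Uniform.
Arguments ket {R d}.
Arguments unif {R d}.

(** * Permutation gates and phase gates *)

Section Gates.
Variables (R : realType) (n w : nat).
Local Notation M := 'M[R[i]]_(dimH n w).
Implicit Types (psi : state R n w) (f g : basis n w -> basis n w).

Definition relabel f : M :=
  \matrix_(a, b) (enum_val a == f (enum_val b))%:R.

(** A permutation matrix moves amplitudes along [f], so the new amplitude at a label is the old one
    at its preimage. *)
Lemma relabel_mulv p (A : 'M[R[i]]_(dimH n w, p)) f g a c :
    cancel f g -> cancel g f ->
  (relabel f *m A) a c = A (enum_rank (g (enum_val a))) c.
Proof.
move=> fK gK; rewrite mxE (bigD1 (enum_rank (g (enum_val a)))) //=.
rewrite mxE enum_rankK gK eqxx mul1r big1 ?addr0 // => b /negPf ba.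
rewrite mxE; case: eqP => [E|]; last by rewrite mul0r.
by rewrite E fK enum_valK eqxx in ba.
Qed.

Lemma relabel_unitary f : involutive f -> relabel f \is unitarymx.
Proof.
move=> fK; apply/unitarymxP.
have -> : (relabel f)^t* = relabel f.
  apply/matrixP => a b; rewrite !mxE rmorph_nat.
  by rewrite -(inj_eq (inv_inj fK)) fK eq_sym.
apply/matrixP => a b; rewrite (relabel_mulv _ _ _ fK fK) !mxE enum_rankK.
by rewrite (inj_eq (inv_inj fK)) (inj_eq enum_val_inj).
Qed.

Definition phase (P : pred (basis n w)) : M :=
  diag_mx (\row_a (-1) ^+ P (enum_val a)).

Lemma phase_mulv P psi a :
  (phase P *m psi) a ord0 = (-1) ^+ P (enum_val a) * psi a ord0.
Proof. by rewrite mul_diag_mx !mxE. Qed.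

Lemma adj_phase P : (phase P)^t* = phase P.
Proof.
apply/matrixP => a b; rewrite !mxE eq_sym rmorphMn /= rmorph_sign.
by case: eqP => [->|].
Qed.

Lemma phase_invol P : phase P *m phase P = 1%:M.
Proof.
apply/matrixP => a b; rewrite mul_diag_mx !mxE mulrnAr.
by case: (a == b); rewrite ?mulr0n // !mulr1n -expr2 sqrr_sign.
Qed.

Lemma phase_unitary P : phase P \is unitarymx.
Proof. by apply/unitarymxP; rewrite adj_phase phase_invol. Qed.

Lemma phase_marked (P : pred (basis n w)) psi a : P (enum_val a) ->
  (phase P *m psi) a ord0 = - psi a ord0.
Proof. by rewrite phase_mulv => ->; rewrite expr1 mulN1r. Qed.

Lemma inner_phase (P : pred (basis n w)) psi :
  inner psi (phase P *m psi) =
  ((\sum_a sqmod (psi a ord0) -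
    2 * \sum_(a | P (enum_val a)) sqmod (psi a ord0))%:C)%C.
Proof.
rewrite innerE [X in _ * X]big_mkcond /= mulr_sumr -sumrB rmorph_sum /=.
apply: eq_bigr => a _; rewrite phase_mulv; case: ifP => _.
  have -> : sqmod (psi a ord0) - 2 * sqmod (psi a ord0) = - sqmod (psi a ord0).
    ring.
  by rewrite rmorphN /= sqmodC expr1 mulN1r mulrN.
by rewrite mulr0 subr0 /= sqmodC expr0 mul1r.
Qed.

End Gates.

(** * A phase oracle built from the neighborhood oracle *)

Section OraclePhase.
Variables (R : realType) (n w : nat) (nbr : 'I_n -> seq 'I_n).
Implicit Types (psi : state R n w) (b : basis n w) (P : pred 'I_n.+1).

Definition flip b : basis n w := let: (v, j, u, z) := b in (v, j, - u, z).

Definition register b : 'I_n.+1 := b.1.2.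

Definition neighbor_unshift b : basis n w :=
  let: (v, j, u, z) := b in (v, j, u - neighbor_at nbr v j, z).

Lemma flipK : involutive flip.
Proof. by move=> [[[v j] u] z]; rewrite /flip opprK. Qed.

Lemma neighbor_shiftK : cancel (neighbor_shift nbr) neighbor_unshift.
Proof. by move=> [[[v j] u] z]; rewrite /= addrK. Qed.

Lemma neighbor_unshiftK : cancel neighbor_unshift (neighbor_shift nbr).
Proof. by move=> [[[v j] u] z]; rewrite /= subrK. Qed.

(* Conjugating the oracle by the negation of its target register inverts it. *)
Lemma oracle_phase P psi :
  relabel R flip *m (neighbor_oracle R w nbr *m (relabel R flip *m
    (phase R (fun b => P (register b)) *m (neighbor_oracle R w nbr *m psi))))
  = phase R (fun b => P (register (neighbor_shift nbr b))) *m psi.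
Proof.
apply/colP => a.
rewrite -[neighbor_oracle _ _ _]/(relabel R (neighbor_shift nbr)).
rewrite (relabel_mulv _ _ _ flipK flipK).
rewrite (relabel_mulv _ _ _ neighbor_shiftK neighbor_unshiftK).
rewrite (relabel_mulv _ _ _ flipK flipK) phase_mulv.
rewrite (relabel_mulv _ _ _ neighbor_shiftK neighbor_unshiftK) phase_mulv.
rewrite !enum_rankK; case E : (enum_val a) => [[[v j] u] z] /=.
rewrite opprB opprK addrC addrK addrC; congr (_ * psi _ _).
by rewrite -[X in enum_rank X]E enum_valK.
Qed.

End OraclePhase.

(** The factors cancel from the inside out. Exchanging [A] with [A'] and [P] with [Q] gives the
    product in the other order, so one lemma serves both halves of [unamplify_mxK]. *)
Lemma sandwichK (F : fieldType) d (A A' P Q : 'M[F]_d) :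
    A' *m A = 1%:M -> A *m A' = 1%:M -> P *m P = 1%:M -> Q *m Q = 1%:M ->
  A' *m (P *m (A *m (Q *m A'))) *m (A *m (Q *m (A' *m (P *m A)))) = 1%:M.
Proof.
move=> AK AK' PK QK.
have K (X Y Z : 'M[F]_d) : X *m Y = 1%:M -> X *m (Y *m Z) = Z.
  by move=> XY; rewrite mulmxA XY mul1mx.
by rewrite -!mulmxA (K _ _ _ AK) (K _ _ _ QK) (K _ _ _ AK') (K _ _ _ PK).
Qed.

(** * Success probabilities of programs; resetting and sampling *)

Section Programs.
Variables (R : realType) (n' w' : nat) (G : sgraph n'.+1).
Variable nbr : 'I_n'.+1 -> seq 'I_n'.+1.
Variable S : pred {ffun 'I_n'.+1 -> nat}.
Local Notation n := n'.+1.
Local Notation w := w'.+1.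
Local Notation prog := (qprog R n w).
Local Notation index := 'I_(dimH n w).
Implicit Types (p : prog) (psi : state R n w) (B : {set index}).

Lemma collapseZ q (m : basis n w -> 'I_q) x s psi :
  collapse m x (s *: psi) = s *: collapse m x psi.
Proof. by apply/colP => a; rewrite !mxE; case: ifP => _; rewrite ?mulr0. Qed.

(** Success is quadratic in the state, so a branch of amplitude [s] weighs [sqmod s] and its
    continuation can be analysed from a normalized state. *)
Lemma prob_fromZ p s psi :
  prob_from G nbr S p (s *: psi) = sqmod s * prob_from G nbr S p psi.
Proof.
elim: p psi => [c|U uU p IH|p IH|q m k IH|v k IH|v j k IH] psi //=.
- case: ifP => _; last by rewrite mulr0.
  rewrite /sqnorm mulr_sumr; apply: eq_bigr => a _.
  by rewrite mxE; exact: sqmodM.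
- by rewrite -scalemxAr.
- by rewrite -scalemxAr.
- by rewrite mulr_sumr; apply: eq_bigr => x _; rewrite collapseZ.
Qed.

Lemma prob_from_Apply (U : 'M_(dimH n w)) (uU : U \is unitarymx) p psi :
  prob_from G nbr S (Apply uU p) psi = prob_from G nbr S p (U *m psi).
Proof. by []. Qed.

Lemma prob_from_ge0 p psi : 0 <= prob_from G nbr S p psi.
Proof.
elim: p psi => [c|U uU p IH|p IH|q m k IH|v k IH|v j k IH] psi //=.
- by case: ifP => // _; apply: sumr_ge0 => a _; apply: sqr_ge0.
- exact: sumr_ge0.
Qed.

Definition origin : index := enum_rank (ord0, ord0, ord0, ord0).

Lemma init_stateE : init_state R n w = ket origin.
Proof.
apply/colP => a; rewrite !mxE eqxx andbT -(inj_eq enum_val_inj) enum_rankK.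
by case: (enum_val a) => [[[v j] u] z]; rewrite !xpair_eqE -!andbA.
Qed.

Definition prob p : R := prob_from G nbr S p (init_state R n w).

Lemma prob_ge0 p : 0 <= prob p.
Proof. exact: prob_from_ge0. Qed.

Lemma prob_Output c : prob (Output R w c) = (S c)%:R.
Proof.
rewrite /prob /= init_stateE; case: (S c) => //.
apply: (fmorph_inj (real_complex R)).
by rewrite -[LHS]inner_sqmod inner_ketl mxE !eqxx rmorph1.
Qed.

(** Measuring the whole label leaves a basis state, which one reflection sends back to [origin].
    Every continuation then starts in the initial state, and success probabilities combine as for
    classical random choices. *)
Definition measure_reset (k : index -> prog) : prog :=
  Measure (fun b => enum_rank b : index)
    (fun a => Apply (refl_unitary (ket a - ket origin)) (k a)).

Lemma prob_measure_reset k psi :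
  prob_from G nbr S (measure_reset k) psi =
  \sum_a sqmod (psi a ord0) * prob (k a).
Proof.
apply: eq_bigr => a _ /=.
have -> : collapse (fun b : basis n w => enum_rank b) a psi =
          psi a ord0 *: ket a.
  apply/colP => b; rewrite !mxE enum_valK eqxx andbT.
  by case: eqP => [->|]; rewrite ?mulr1 ?mulr0.
rewrite -scalemxAr refl_ket_ket; apply: etrans (prob_fromZ _ _ _) _.
by rewrite /prob init_stateE.
Qed.

Definition sample B (k : index -> prog) : prog :=
  Apply (refl_unitary (ket origin - unif B)) (measure_reset k).

Lemma prob_sample B k : (0 < #|B|)%N ->
  prob (sample B k) = #|B|%:R^-1 * \sum_(a in B) prob (k a).
Proof.
move=> B0; rewrite {1}/prob prob_from_Apply init_stateE refl_ket_unif //.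
apply: etrans (prob_measure_reset _ _) _.
rewrite mulr_sumr [RHS]big_mkcond.
by apply: eq_bigr => a _; rewrite sqmod_unif; case: ifP => _ //; rewrite mul0r.
Qed.

(** * Amplitude amplification over one set of labels *)

Section Search.
Variables (B : {set index}) (P : pred 'I_n.+1).
Hypothesis B0 : (0 < #|B|)%N.

Definition marked (b : basis n w) := P (register (neighbor_shift nbr b)).

(** Computing the neighbor, applying the phase and uncomputing costs two oracle calls. *)
Definition phase_query p : prog :=
  QuantumQuery (Apply (phase_unitary R (fun b => P (register b)))
    (Apply (relabel_unitary R (@flipK n w))
       (QuantumQuery (Apply (relabel_unitary R (@flipK n w)) p)))).

Lemma prob_phase_query p psi :
  prob_from G nbr S (phase_query p) psi =
  prob_from G nbr S p (phase R marked *m psi).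
Proof. by rewrite /= oracle_phase. Qed.

(* Recursive amplitude amplification: level k+1 runs level k, reflects in the
   marked labels, then reflects in the state prepared by level k. *)
Fixpoint amplify k p : prog :=
  if k is k'.+1 then
    amplify k' (phase_query (unamplify k'
      (Apply (refl_unitary (ket origin)) (amplify k' p))))
  else Apply (refl_unitary (ket origin - unif B)) p
with unamplify k p : prog :=
  if k is k'.+1 then
    unamplify k' (Apply (refl_unitary (ket origin)) (amplify k'
      (phase_query (unamplify k' p))))
  else Apply (refl_unitary (ket origin - unif B)) p.

(** Programs list gates in temporal order, so the matrix factors appear in reverse order. At level 0
    the reflection is its own inverse. *)
Fixpoint amplify_mx k : 'M[R[i]]_(dimH n w) :=
  if k is k'.+1 then
    amplify_mx k' *m (refl (ket origin) *m (unamplify_mx k' *m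
      (phase R marked *m amplify_mx k')))
  else refl (ket origin - unif B)
with unamplify_mx k : 'M[R[i]]_(dimH n w) :=
  if k is k'.+1 then
    unamplify_mx k' *m (phase R marked *m (amplify_mx k' *m
      (refl (ket origin) *m unamplify_mx k')))
  else refl (ket origin - unif B).

Lemma prob_amplify_mx k :
  (forall p psi, prob_from G nbr S (amplify k p) psi =
                 prob_from G nbr S p (amplify_mx k *m psi)) /\
  (forall p psi, prob_from G nbr S (unamplify k p) psi =
                 prob_from G nbr S p (unamplify_mx k *m psi)).
Proof.
elim: k => [|k [IHa IHu]]; first by [].
split=> p psi.
  rewrite [amplify _ _]/= IHa prob_phase_query IHu prob_from_Apply IHa.
  by rewrite -!mulmxA.
rewrite [unamplify _ _]/= IHu prob_from_Apply IHa prob_phase_query IHu.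
by rewrite -!mulmxA.
Qed.

Lemma adj_amplify_mx k : (amplify_mx k)^t* = unamplify_mx k.
Proof.
elim: k => [|k IH] /=; first exact: adj_refl.
rewrite !adjM adj_refl adj_phase -IH trmxCK.
by rewrite !mulmxA.
Qed.

Lemma unamplify_mxK k : unamplify_mx k *m amplify_mx k = 1%:M.
Proof.
(* Both products go through the induction together, since each step uses the two of them. *)
suff [] : unamplify_mx k *m amplify_mx k = 1%:M /\
          amplify_mx k *m unamplify_mx k = 1%:M by [].
elim: k => [|k [IH IH']]; first by rewrite /= refl_invol.
have Z := phase_invol R marked; have Y := refl_invol (ket origin : state R n w).
by split; [exact: sandwichK IH IH' Z Y | exact: sandwichK IH' IH Y Z].
Qed.

Definition amplified k : state R n w := amplify_mx k *m ket origin.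

Definition mass k : R :=
  \sum_(a | marked (enum_val a)) sqmod (amplified k a ord0).

Lemma amplified_norm k : \sum_a sqmod (amplified k a ord0) = 1.
Proof.
apply: (fmorph_inj (real_complex R)); rewrite -[LHS]inner_sqmod rmorph1.
rewrite /amplified inner_adj adj_amplify_mx mulmxA unamplify_mxK mul1mx.
by rewrite inner_ketl mxE !eqxx.
Qed.

Lemma mass_ge0 k : 0 <= mass k.
Proof. by apply: sumr_ge0 => a _; apply: sqmod_ge0. Qed.

Lemma mass_le1 k : mass k <= 1.
Proof.
rewrite -(amplified_norm k) /mass big_mkcond; apply: ler_sum => a _.
by case: ifP => // _; apply: sqmod_ge0.
Qed.

Lemma mass0 : mass 0 = #|[set a in B | marked (enum_val a)]|%:R / #|B|%:R.
Proof.
rewrite /mass /amplified /= refl_ket_unif //.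
under eq_bigr do rewrite sqmod_unif.
rewrite -big_mkcondr /= sumr_const mulr_natl; congr (_ *+ _).
by apply: eq_card => a; rewrite !inE andbC.
Qed.

(* For the marked part this is the triple-angle formula for the sine. *)
Lemma massS k : mass k.+1 = mass k * (4 * mass k - 3) ^+ 2.
Proof.
rewrite [in RHS]mulrC /mass mulr_sumr; apply: eq_bigr => a ma.
(* With [psi] the level [k] state and [S] the phase gate, the new state is
   [S psi - 2 <psi, S psi> psi], where [<psi, S psi> = 1 - 2 * mass k]. On a marked label the
   amplitude is thus multiplied by [-1 - 2 * (1 - 2 * mass k) = 4 * mass k - 3]. *)
have -> : amplified k.+1 = phase R marked *m amplified k -
    (2 * (1 - 2 * mass k)%:C)%C *: amplified k.
  rewrite /amplified /= -!mulmxA.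
  set psi := amplify_mx k *m ket origin.
  have K (A : state R n w) : amplify_mx k *m (unamplify_mx k *m A) = A.
    rewrite mulmxA -adj_amplify_mx mulmx1C ?mul1mx //.
    by rewrite adj_amplify_mx unamplify_mxK.
  rewrite refl_mulv mulmxBr K -scalemxAr -/psi; congr (_ - _ *: _).
  rewrite -adj_amplify_mx.
  rewrite -inner_adj -/psi inner_phase (amplified_norm k) inner_ketl mxE !eqxx.
  by rewrite divr1.
rewrite mxE [X in _ + X]mxE [X in _ - X]mxE.
rewrite phase_marked // -sqmod_real -sqmodM; congr sqmod.
rewrite -/(mass k) !rmorphB !rmorphM /= !rmorph_nat rmorph1; ring.
Qed.

(** A classical query rechecks the measured label, so [found] is entered only at a marked one. *)
Definition verify (found notfound : prog) (a : index) : prog :=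
  let: (v, j, u, z) := enum_val a in
  NeighborQuery v j (fun y => if P (u + y) then found else notfound).

Definition search_level k (found notfound : prog) : prog :=
  amplify k (measure_reset (verify found notfound)).

Lemma prob_search_level k found notfound :
  prob (search_level k found notfound) =
  mass k * prob found + (1 - mass k) * prob notfound.
Proof.
rewrite /prob /search_level (prob_amplify_mx k).1 init_stateE.
rewrite prob_measure_reset -/(amplified k).
rewrite -(amplified_norm k) (bigID (fun a => marked (enum_val a))) /=.
rewrite [X in X - mass k](bigID (fun a => marked (enum_val a))) /=.
rewrite -/(mass k) addrAC subrr add0r !mulr_suml.
congr (_ + _); apply: eq_bigr => a.
  rewrite /marked /register /verify; case: (enum_val a) => [[[v j] u] z] /=.
  by rewrite /prob /= => ->; rewrite init_stateE.
rewrite /marked /register /verify; case: (enum_val a) => [[[v j] u] z] /=.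
by rewrite /prob /= => /negPf ->; rewrite init_stateE.
Qed.

End Search.
End Programs.

Arguments search_level : simpl never.

(* As long as the success probability stays below 1/4, the odds of success
   grow by a factor at least 9 from one level to the next. *)
Lemma amplification_reaches_quarter (R : realType) (p : nat -> R) (N : R) K :
    (forall k, 0 <= p k <= 1) ->
    (forall k, p k.+1 = p k * (4 * p k - 3) ^+ 2) ->
    1 <= N * p 0%N -> 0 <= N -> N <= 9 ^+ K ->
  exists2 k, (k <= K)%N & 1 / 4 <= p k.
Proof.
move=> p01 pS N0 N_ge0 NK.
case: (boolP [exists k : 'I_K.+1, 1 / 4 <= p k]) => [/existsP[k pk]|].
  by exists k => //; rewrite -ltnS.
rewrite negb_exists => /forallP small.
have lt4 k : (k <= K)%N -> p k < 1 / 4.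
  by move=> kK; have := small (Ordinal (kK : (k < K.+1)%N)); rewrite -ltNge.
(* The bound [9 ^+ k / N] on the odds, cleared of denominators; it starts from [1 <= N * p 0]. *)
have odds k : (k <= K)%N -> 9 ^+ k * (1 - p k) <= N * p k.
  elim: k => [|k IH] kK; first by rewrite expr0; have := p01 0%N; lra.
  have /IH odds : (k <= K)%N by exact: ltnW.
  have p4 := lt4 k (ltnW kK); have /andP[p0 _] := p01 k.
  (* [1 - p * (4 * p - 3) ^+ 2] factors as [(1 - p) * (1 - 4 * p) ^+ 2]. *)
  have -> : 9 ^+ k.+1 * (1 - p k.+1) =
            9 * (1 - 4 * p k) ^+ 2 * (9 ^+ k * (1 - p k)).
    by rewrite exprS pS; ring.
  apply: (@le_trans _ _ (9 * (1 - 4 * p k) ^+ 2 * (N * p k))).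
    by apply: ler_wpM2l odds; rewrite mulr_ge0 ?sqr_ge0.
  have -> : N * p k.+1 = (4 * p k - 3) ^+ 2 * (N * p k) by rewrite pS; ring.
  apply: ler_wpM2r; first exact: mulr_ge0.
  have -> : (4 * p k - 3) ^+ 2 =
            9 * (1 - 4 * p k) ^+ 2 + 16 * p k * (3 - 8 * p k).
    by ring.
  by rewrite lerDl mulr_ge0 //; lra.
(* As [N <= 9 ^+ K], the odds at [K] are at least 1, which contradicts [p K < 1 / 4]. *)
have := odds K (leqnn K); have := lt4 K (leqnn K); have /andP[p0 p1] := p01 K.
have : N * p K <= 9 ^+ K * p K by exact: ler_wpM2r.
have : (1 : R) <= 9 ^+ K by apply: exprn_ege1; lra.
set e := 9 ^+ K; move=> e1 h1 h2 h3; exfalso.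
have : 0 < e * (1 - 2 * p K) by rewrite mulr_gt0 //; lra.
have -> : e * (1 - 2 * p K) = e * (1 - p K) - e * p K by ring.
lra.
Qed.

(** * Searching all levels repeatedly: error and query cost *)

Section RepeatedSearch.
Variables (R : realType) (n' w' : nat) (G : sgraph n'.+1).
Variable nbr : 'I_n'.+1 -> seq 'I_n'.+1.
Local Notation n := n'.+1.
Local Notation w := w'.+1.
Local Notation prog := (qprog R n w).
Local Notation index := 'I_(dimH n w).
Variables (S : pred {ffun 'I_n -> nat}) (B : {set index}) (P : pred 'I_n.+1).
Implicit Types (p found notfound : prog).
Local Notation prob := (prob G nbr S).
Local Notation mass := (mass R nbr B P).
Local Notation queries := (neighbor_queries G nbr).

(** The number of marked labels is unknown, so no single level can be fixed in advance. *)
Fixpoint search_levels k found notfound : prog :=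
  search_level B P k found
    (if k is k'.+1 then search_levels k' found notfound else notfound).

Definition miss k : R := \prod_(i < k.+1) (1 - mass i).

Lemma prob_search_levels k found notfound :
  prob (search_levels k found notfound) =
  (1 - miss k) * prob found + miss k * prob notfound.
Proof.
elim: k => [|k IH] /=; rewrite prob_search_level // /miss big_ord_recr /=.
  by rewrite big_ord0; ring.
by rewrite IH -/(miss k); ring.
Qed.

Definition search k r found notfound : prog :=
  iter r (search_levels k found) notfound.

Lemma prob_search k r found notfound :
  prob (search k r found notfound) =
  (1 - miss k ^+ r) * prob found + miss k ^+ r * prob notfound.
Proof.
rewrite /search; elim: r => [|r IH] /=; first by rewrite expr0; ring.
by rewrite prob_search_levels IH exprS; ring.
Qed.

Lemma miss_bounds k : 0 <= miss k <= 1.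
Proof.
rewrite /miss prodr_ge0 /= => [|i _]; last by rewrite subr_ge0 mass_le1.
apply: prodr_ile1 => i _.
by rewrite subr_ge0 mass_le1 // lerBlDr lerDl mass_ge0.
Qed.

(** The cost [3 ^ k - 1] solves [c' = 3 * c + 2]: three runs of the lower level and one phase query.
    Adding 1 on the left avoids subtraction. *)
Lemma queries_amplify k :
  (forall p, queries (amplify B P k p) + 1 = queries p + 3 ^ k)%N /\
  (forall p, queries (unamplify B P k p) + 1 = queries p + 3 ^ k)%N.
Proof.
elim: k => [|k [IHa IHu]] //; rewrite expnS; split=> p /=.
  set q := phase_query _ _; have := IHa q; rewrite /q /=.
  have := IHu (Apply (refl_unitary (ket (origin n' w'))) (amplify B P k p)).
  by have := IHa p; rewrite /=; lia.
set q := Apply _ _; have := IHu q; rewrite /q /=.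
have := IHa (phase_query P (unamplify B P k p)).
by have := IHu p; rewrite /=; lia.
Qed.

Lemma queries_search_level k found notfound M :
    (queries found <= M)%N -> (queries notfound <= M)%N ->
  (queries (search_level B P k found notfound) <= M + 3 ^ k)%N.
Proof.
move=> fM nM; rewrite /search_level.
set p := measure_reset _; have := (queries_amplify k).1 p.
suff : (queries p <= M.+1)%N by lia.
apply/bigmax_leqP => a _ /=; rewrite /verify.
by case: (enum_val a) => [[[v j] u] z] /=; case: ifP.
Qed.

Lemma queries_search_levels k found notfound M :
    (queries found <= M)%N -> (queries notfound <= M)%N ->
  (queries (search_levels k found notfound) <=
   M + \sum_(i < k.+1) 3 ^ i)%N.
Proof.
move=> fM nM; elim: k => [|k IH]; rewrite [search_levels _ _ _]/=.
  by rewrite big_ord1; apply: queries_search_level.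
rewrite big_ord_recr /= addnA; apply: queries_search_level => //.
exact: leq_trans (leq_addr _ _).
Qed.

Lemma queries_search k r found notfound M :
    (queries found <= M)%N -> (queries notfound <= M)%N ->
  (queries (search k r found notfound) <=
   M + r * \sum_(i < k.+1) 3 ^ i)%N.
Proof.
move=> fM nM; rewrite /search; elim: r => [|r IH]; first by rewrite addn0.
rewrite mulSnr addnA; apply: queries_search_levels => //.
exact: leq_trans (leq_addr _ _).
Qed.

Hypothesis B0 : (0 < #|B|)%N.

(** The initial mass is 0 and the recursion [massS] keeps it 0. *)
Lemma miss_unmarked k :
  {in B, forall a, ~~ marked nbr P (enum_val a)} -> miss k = 1.
Proof.
move=> unmarked; rewrite /miss big1 // => i _.
suff -> : mass i = 0 by rewrite subr0.
elim: (i : nat) => [|j IH]; last by rewrite massS // IH mul0r.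
rewrite mass0 //; suff -> : [set a in B | marked nbr P (enum_val a)] = set0.
  by rewrite cards0 mul0r.
apply/setP => a; rewrite !inE; apply/negP => /andP[aB].
exact/negP/unmarked.
Qed.

(** One marked label makes the initial mass at least [1 / #|B|], so some level up to [k] has mass at
    least 1/4; the other factors of [miss] are at most 1. *)
Lemma miss_marked k a : (#|B| <= 9 ^ k)%N ->
  a \in B -> marked nbr P (enum_val a) -> miss k <= 3 / 4.
Proof.
move=> Bk aB ma.
have [|||||i ik m4] := @amplification_reaches_quarter R mass #|B|%:R k.
- by move=> j; rewrite mass_ge0 mass_le1.
- by move=> j; apply: massS.
- rewrite mass0 // mulrC divfK ?pnatr_eq0 -?lt0n // ler1n.
  by apply/card_gt0P; exists a; rewrite inE aB.
- exact: ler0n.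
- by rewrite -natrX ler_nat.
rewrite /miss (bigD1 (Ordinal (ik : (i < k.+1)%N))) //=.
apply: (@le_trans _ _ ((1 - mass i) * 1)); last by lra.
apply: ler_wpM2l; first by rewrite subr_ge0 mass_le1.
apply: prodr_ile1 => j _.
by rewrite subr_ge0 mass_le1 // lerBlDr lerDl mass_ge0.
Qed.

End RepeatedSearch.

(** * Coloring by random draws and conflict search *)

Section Coloring.
Variables (R : realType) (n' w' : nat).
Local Notation n := n'.+1.
Local Notation w := w'.+1.
Local Notation prog := (qprog R n w).
Local Notation index := 'I_(dimH n w).
(* [D] is the maximum degree, [K] the palette size, [r] the number of
   repetitions of each search, whose highest level is [lev], and [T] the number
   of colors drawn for each vertex before giving up. *)
Variables (D K lev r T : nat).
Implicit Types (c : {ffun 'I_n -> nat}) (v u : 'I_n) (vs : seq 'I_n).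

(** [ord0] stands for a missing neighbor and carries no color, so positions beyond the degree are
    never marked. *)
Definition has_color c (x : nat) : pred 'I_n.+1 :=
  fun y => if unlift ord0 y is Some u then c u == x else false.

(** Searching only [D] positions makes the cost scale with the square root of [D] instead of [n]. *)
Definition slots v : {set index} :=
  [set enum_rank ((v, j, ord0, ord0) : basis n w)
     | j in [set j : 'I_n | (j < D)%N]].

Definition palette : {set index} := [set a : index | (a < K)%N].

Definition recolor c v (x : nat) : {ffun 'I_n -> nat} :=
  [ffun u => if u == v then x else c u].

(** A reported conflict leads to a new draw. When the draws are exhausted the unfinished coloring is
    output, a branch whose success is bounded below by 0 only. *)
Fixpoint color_vertex t v c (next : {ffun 'I_n -> nat} -> prog) : prog :=
  if t is t'.+1 then
    sample palette (fun a =>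
      search (slots v) (has_color c a) lev r
        (color_vertex t' v c next) (next (recolor c v a)))
  else Output _ _ c.

Fixpoint color_all vs c : prog :=
  if vs is v :: vs' then color_vertex T v c (color_all vs') else Output _ _ c.

Variables (G : sgraph n) (nbr : 'I_n -> seq 'I_n).
Hypothesis nbrP : neighbor_ordering G nbr.
Local Notation prob := (prob G nbr (proper_coloring G K)).
Local Notation queries := (neighbor_queries G nbr).

(** Neighbors not yet colored count too, with their placeholder color; each neighbor still blocks
    only one color. *)
Definition free c v (x : nat) := ~~ [exists u, edge G v u && (c u == x)].

Lemma size_nbr v : size (nbr v) = degree G v.
Proof.
have [Uv Ev] := nbrP v; rewrite -(card_uniqP Uv); apply: eq_card => u.
by rewrite inE Ev.
Qed.

(** With target register 0 the oracle writes the neighbor itself, and [D <= n] makes every position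
    below the degree a legal index. *)
Lemma marked_slots c v x : (degree G v <= D)%N -> (D <= n)%N ->
  (~~ free c v x) =
  [exists a in slots v, marked nbr (has_color c x) (enum_val a)].
Proof.
move=> dD Dn; rewrite /free negbK; apply/existsP/exists_inP.
  move=> [u /andP[vu /eqP cu]]; have u_nbr : u \in nbr v by rewrite (nbrP v).2.
  have iu : (seq.index u (nbr v) < degree G v)%N by rewrite -size_nbr index_mem.
  have iD := leq_trans iu dD.
  exists (enum_rank ((v, Ordinal (leq_trans iD Dn), ord0, ord0) : basis n w)).
    by apply/imsetP; exists (Ordinal (leq_trans iD Dn)); rewrite ?inE.
  rewrite enum_rankK /marked /register /= add0r /neighbor_at /=.
  by rewrite (nth_map u) ?index_mem // nth_index // /has_color liftK cu.
move=> [a /imsetP[j _ ->]]; rewrite enum_rankK /marked /register /= add0r.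
rewrite /neighbor_at /has_color; case: (ltnP j (size (nbr v))) => jv.
  rewrite (nth_map v) // liftK => cu; exists (nth v (nbr v) j).
  by rewrite cu andbT -[edge G v _]/(_ \in edge G v) -(nbrP v).2 mem_nth.
by rewrite nth_default ?size_map // unlift_none.
Qed.

Lemma card_slots v : (#|slots v| <= D)%N.
Proof.
apply: leq_trans (leq_imset_card _ _) _.
rewrite cardE -(size_map val) -[leqRHS](size_iota 0 D); apply: uniq_leq_size.
  by rewrite (map_inj_uniq val_inj) enum_uniq.
by move=> i /mapP[j]; rewrite mem_enum inE mem_iota => ? ->.
Qed.

Lemma slots_gt0 v : (0 < D)%N -> (0 < #|slots v|)%N.
Proof.
move=> D0; apply/card_gt0P.
exists (enum_rank ((v, ord0, ord0, ord0) : basis n w)).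
by apply/imsetP; exists ord0; rewrite ?inE.
Qed.

Hypothesis K_dim : (K <= dimH n w)%N.

Lemma card_palette : #|palette| = K.
Proof.
rewrite cardE -(size_map val) -[RHS](size_iota 0 K).
apply/perm_size/uniq_perm; first by rewrite (map_inj_uniq val_inj) enum_uniq.
  exact: iota_uniq.
move=> i; rewrite mem_iota /= add0n; apply/mapP/idP => [[a]|iK].
  by rewrite mem_enum inE => aK ->.
by exists (Ordinal (leq_trans iK K_dim)); rewrite ?mem_enum ?inE.
Qed.

(** A blocked color is the color of some neighbor, so at most [degree G v] colors are blocked. *)
Lemma card_free c v :
  (K <= #|[set a in palette | free c v a]| + degree G v)%N.
Proof.
rewrite -card_palette -(cardsID [set a : index | free c v a]).
rewrite leq_add //.
  by apply: subset_leq_card; apply/subsetP => a; rewrite !inE.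
rewrite -size_nbr -(size_map c) cardE -(size_map val).
apply: uniq_leq_size => [|x]; first by rewrite (map_inj_uniq val_inj) enum_uniq.
move=> /mapP[a]; rewrite mem_enum !inE negbK => /andP[/existsP[u]].
move=> /andP[vu /eqP cu] _ ->; rewrite /= -cu.
by apply: map_f; rewrite (nbrP v).2.
Qed.

(* Each attempt succeeds with probability at least [s]; [delta] bounds the
   probability that a conflict is overlooked in one attempt. *)
Lemma prob_color_vertex (s delta L : R) t v c next :
    (0 < D <= n)%N -> (degree G v <= D <= 9 ^ lev)%N -> (0 < K)%N ->
    0 < s <= 1 -> s * K%:R + D%:R <= K%:R ->
    (3 / 4) ^+ r <= delta <= 1 -> 0 <= L ->
    (forall x, (x < K)%N -> free c v x -> L <= prob (next (recolor c v x))) ->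
  L * (1 - (1 - s) ^+ t - delta / s) <= prob (color_vertex t v c next).
Proof.
move=> /andP[D0 Dn] /andP[dD Dlev] K0 /andP[s0 s1] sK /andP[rdelta d1] L0 Lnext.
have d0 : 0 <= delta by apply: le_trans rdelta; apply: exprn_ge0; lra.
elim: t => [|t IH].
  rewrite expr0 subrr add0r; apply: le_trans (prob_ge0 _ _ _ _).
  by rewrite mulrN oppr_le0 mulr_ge0 // divr_ge0 // ltW.
rewrite [color_vertex _ _ _ _]/= prob_sample ?card_palette //.
set h := 1 - (1 - s) ^+ t - delta / s in IH *.
set X := (X in \sum_(a in _) X a).
have h1 : h <= 1.
  rewrite /h; have : 0 <= (1 - s) ^+ t by apply: exprn_ge0; lra.
  by have : 0 <= delta / s by [rewrite divr_ge0 // ltW]; lra.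
(* [y] is the bound, relative to [L], after drawing a blocked color: the conflict is seen with
   probability at least [1 - delta], then the induction hypothesis applies. *)
set y := (1 - delta) * h.
have y1 : y <= 1 by rewrite /y; nra.
have Xge a : a \in palette ->
    L * (y + (if free c v a then 1 - y else 0)) <= X a.
  rewrite inE => aK; rewrite /X prob_search ?slots_gt0 //.
  case: ifP => fa.
    rewrite miss_unmarked ?slots_gt0 // => [|b bs].
      rewrite expr1n subrr mul0r add0r mul1r.
      by rewrite addrC subrK mulr1; exact: Lnext.
    move: (marked_slots c a dD Dn); rewrite fa => /esym/negbT.
    by rewrite negb_exists_in => /forall_inP/(_ b bs).
  move: (marked_slots c a dD Dn); rewrite fa => /esym/exists_inP[b bs mb].
  have /andP[m0 m1] := miss_bounds R nbr (slots v) (has_color c a) lev.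
  have m34 := miss_marked R (slots_gt0 v D0)
    (leq_trans (card_slots v) Dlev) bs mb.
  set m := miss _ _ _ _ _ in m0 m1 m34 *.
  have mr : m ^+ r <= delta.
    by apply: le_trans rdelta; apply: lerXn2r; rewrite ?nnegrE //; lra.
  rewrite addr0 -[leLHS]addr0; apply: lerD; last first.
    by rewrite mulr_ge0 ?prob_ge0 // exprn_ge0.
  apply: (@le_trans _ _ ((1 - delta) * prob (color_vertex t v c next))).
    by rewrite /y mulrCA; apply: ler_wpM2l => //; rewrite subr_ge0.
  by apply: ler_wpM2r; rewrite ?prob_ge0 // lerD2l lerN2.
have Kr : 0 < K%:R :> R by rewrite ltr0n.
rewrite -(ler_pM2l Kr) [leRHS]mulrA divff ?gt_eqF // mul1r.
apply: le_trans (ler_sum _ Xge).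
rewrite -mulr_sumr big_split /= sumr_const card_palette -big_mkcondr /=.
rewrite sumr_const mulrCA; apply: ler_wpM2l => //.
set F := #|_|.
have KF : K%:R <= F%:R + D%:R :> R.
  rewrite -natrD ler_nat; apply: leq_trans (card_free c v) _.
  rewrite leq_add //.
  by apply: subset_leq_card; apply/subsetP => a; rewrite inE.
have FK : s * K%:R <= F%:R by lra.
rewrite -(mulr_natl y) -(mulr_natl (1 - y)).
(* As [1 - y >= 0], the number [F] of free colors may be lowered to [s * K%:R]. *)
apply: (@le_trans _ _ (K%:R * y + s * K%:R * (1 - y))); last first.
  by rewrite lerD2l; apply: ler_wpM2r => //; rewrite subr_ge0.
have -> : K%:R * y + s * K%:R * (1 - y) = K%:R * (y + s * (1 - y)) by ring.
apply: ler_wpM2l; first exact: ltW.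
have hy : h - delta <= y by rewrite /y; nra.
suff : 1 - (1 - s) ^+ t.+1 - delta / s <= (h - delta) + s * (1 - (h - delta)).
  have : 0 <= (1 - s) * (y - (h - delta)) by apply: mulr_ge0; lra.
  by nra.
(* The error term [q = delta / s] survives one more attempt: [(1 - s) * (q + delta) = q - s * delta
   <= q]. *)
rewrite /h exprS; set e := (1 - s) ^+ t.
have E : delta / s * s = delta by rewrite divfK // gt_eqF.
have : 0 <= delta * s by apply: mulr_ge0 => //; exact: ltW.
move: E; set q := delta / s => E; nra.
Qed.

(** The loop invariant: [vs] lists the vertices still to be colored, whose current values are
    unconstrained. *)
Definition colored_outside vs c :=
  (forall u, u \notin vs -> (c u < K)%N) /\
  (forall u u', edge G u u' -> u \notin vs -> u' \notin vs -> c u != c u').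

Lemma recolor_outside v vs c x : (x < K)%N -> free c v x ->
  colored_outside (v :: vs) c -> colored_outside vs (recolor c v x).
Proof.
move=> xK fx [cK cN]; split=> [u uvs|u u' uu' uvs u'vs]; rewrite !ffunE.
  by case: eqP => // /eqP uv; apply: cK; rewrite inE negb_or uv.
have fN y : edge G v y -> c y != x.
  move=> vy; apply: contraNneq fx => cy.
  by apply/existsP; exists y; rewrite vy cy eqxx.
case: (eqVneq u v) => uv; case: (eqVneq u' v) => u'v.
- by rewrite uv u'v edge_irr in uu'.
- by rewrite eq_sym fN // -uv.
- by rewrite fN // edge_sym -u'v.
- by apply: cN; rewrite ?inE ?negb_or ?uv ?u'v.
Qed.

(** Each vertex succeeds with probability at least [h] whatever valid colors were chosen before, so
    the bounds multiply. *)
Lemma prob_color_all (s delta h : R) vs c :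
    (0 < D <= n)%N -> (forall v, degree G v <= D)%N -> (D <= 9 ^ lev)%N ->
    (0 < K)%N -> 0 < s <= 1 -> s * K%:R + D%:R <= K%:R ->
    (3 / 4) ^+ r <= delta <= 1 ->
    0 <= h -> h <= 1 - (1 - s) ^+ T - delta / s ->
    colored_outside vs c ->
  h ^+ size vs <= prob (color_all vs c).
Proof.
move=> Dn dD Dlev K0 s01 sK d01 h0 hT.
elim: vs c => [|v vs IH] c cc.
  rewrite /= prob_Output expr0; suff -> : proper_coloring G K c by [].
  apply/andP; split; first by apply/forallP => u; apply: cc.1.
  apply/forallP => u; apply/forallP => u'; apply/implyP => uu'.
  exact: cc.2.
have hv0 : 0 <= h ^+ size vs by exact: exprn_ge0.
rewrite [size _]/= exprSr; apply: le_trans (ler_wpM2l hv0 hT) _.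
apply: prob_color_vertex => //; first by rewrite dD.
by move=> x xK fx; apply: IH; apply: recolor_outside.
Qed.

Lemma queries_color_vertex t v c next M :
    (forall c', queries (next c') <= M)%N ->
  (queries (color_vertex t v c next) <=
   M + t * (r * \sum_(i < lev.+1) 3 ^ i))%N.
Proof.
move=> nM; elim: t => [|t IH]; first by rewrite /= leq0n.
rewrite [color_vertex _ _ _ _]/=; apply/bigmax_leqP => a _.
rewrite mulSnr addnA; apply: queries_search => //.
exact: leq_trans (nM _) (leq_addr _ _).
Qed.

Lemma queries_color_all vs c :
  (queries (color_all vs c) <=
   size vs * (T * (r * \sum_(i < lev.+1) 3 ^ i)))%N.
Proof.
elim: vs c => [|v vs IH] c //=; rewrite mulSnr.
exact: queries_color_vertex.
Qed.

End Coloring.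

(** * Finding the maximum degree by degree queries *)

Section MaxDegree.
Variables (R : realType) (n w : nat) (G : sgraph n) (nbr : 'I_n -> seq 'I_n).

Fixpoint with_max_degree (vs : seq 'I_n) (D : nat) (k : nat -> qprog R n w) :=
  if vs is v :: vs' then
    DegreeQuery v (fun d => with_max_degree vs' (maxn D d) k)
  else k D.

Lemma prob_with_max_degree S vs D k psi :
  prob_from G nbr S (with_max_degree vs D k) psi =
  prob_from G nbr S (k (maxn D (\max_(v <- vs) degree G v))) psi.
Proof.
elim: vs D => [|v vs IH] D /=; first by rewrite big_nil maxn0.
by rewrite IH big_cons maxnA.
Qed.

Lemma queries_with_max_degree vs D k :
  neighbor_queries G nbr (with_max_degree vs D k) =
  neighbor_queries G nbr (k (maxn D (\max_(v <- vs) degree G v))).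
Proof.
elim: vs D => [|v vs IH] D /=; first by rewrite big_nil maxn0.
by rewrite IH big_cons maxnA.
Qed.

Lemma degree_le_max v : (degree G v <= max_degree G)%N.
Proof. exact: (leq_bigmax v). Qed.

Lemma max_degree_le : (max_degree G <= n.-1)%N.
Proof.
apply/bigmax_leqP => v _; rewrite -[n in n.-1]card_ord -(cardsC1 v).
apply: subset_leq_card; apply/subsetP => u; rewrite !inE => vu.
by apply: contraTneq vu => ->; rewrite edge_irr.
Qed.

End MaxDegree.

(** * Numerical estimates for the parameters *)

Section Estimates.
Variable R : realType.

Lemma bernoulli_ge (x : R) m : -1 <= x -> 1 + m%:R * x <= (1 + x) ^+ m.
Proof.
move=> x1; elim: m => [|m IH]; first by rewrite expr0; lra.
rewrite exprS; apply: le_trans (ler_wpM2l _ IH); last by lra.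
have : 0 <= m%:R * x ^+ 2 by rewrite mulr_ge0 ?sqr_ge0.
by rewrite -natr1; nra.
Qed.

(** With [s = 1 / q], Bernoulli gives [(1 + s) ^+ q >= 2], while the product [(1 - s ^+ 2) ^+ q] is
    at most 1. *)
Lemma subr_inv_expr_half q : (0 < q)%N -> (1 - q%:R^-1 : R) ^+ q <= 2^-1.
Proof.
move=> q0; have q0' : 0 < q%:R :> R by rewrite ltr0n.
set s := q%:R^-1; have s0 : 0 < s by rewrite invr_gt0.
have s1 : s <= 1 by rewrite invf_le1 // ler1n.
have qs : q%:R * s = 1 by rewrite mulfV // gt_eqF.
have : (2 : R) <= (1 + s) ^+ q.
  by apply: le_trans (bernoulli_ge _ _); rewrite ?qs; lra.
have : (1 - s) ^+ q * (1 + s) ^+ q <= 1.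
  by rewrite -exprMn; apply: exprn_ile1; nra.
have : 0 <= (1 - s) ^+ q by apply: exprn_ge0; lra.
by set a := (1 - s) ^+ q; set b := (1 + s) ^+ q; nra.
Qed.

Lemma attempts_fail_bound q l m : (0 < q)%N -> (m <= 2 ^ l)%N -> (0 < m)%N ->
  (1 - q%:R^-1 : R) ^+ (q * l) <= m%:R^-1.
Proof.
move=> q0 ml m0; rewrite exprM.
apply: (@le_trans _ _ (2^-1 ^+ l)).
  apply: lerXn2r (subr_inv_expr_half q0); rewrite ?nnegrE ?invr_ge0 //.
  by apply: exprn_ge0; rewrite subr_ge0 invf_le1 ?ltr0n // ler1n.
by rewrite exprVn lef_pV2 ?posrE ?exprn_gt0 ?ltr0n // -natrX ler_nat.
Qed.

(** [(3 / 4) ^+ 3 = 27 / 64] is below 1/2. Of the [l + q] halvings, [l] give [1 / m] and [q] absorb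
    the factor [q <= 2 ^ q]. *)
Lemma overlook_bound q l m : (m <= 2 ^ l)%N -> (0 < m)%N ->
  (3 / 4 : R) ^+ (3 * (l + q)) * q%:R <= m%:R^-1.
Proof.
move=> ml m0; rewrite exprM.
apply: (@le_trans _ _ (2^-1 ^+ (l + q) * q%:R)).
  apply: ler_wpM2r => //; apply: lerXn2r; rewrite ?nnegrE ?invr_ge0 //.
    by apply: exprn_ge0; lra.
  by rewrite !exprS expr0; lra.
rewrite exprD -mulrA; apply: (@le_trans _ _ (2^-1 ^+ l * 1)).
  apply: ler_wpM2l; first by rewrite exprn_ge0 // invr_ge0.
  rewrite exprVn ler_pdivrMl ?exprn_gt0 // mulr1 -natrX ler_nat.
  exact/ltnW/ltn_expl.
by rewrite mulr1 exprVn lef_pV2 ?posrE ?exprn_gt0 ?ltr0n // -natrX ler_nat.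
Qed.

(** By minimality of [up_log], [9 ^ lev <= 9 * D], so [3 ^ lev] is at most three times the root of
    [D]; the geometric sum is below [3 ^ lev.+1 / 2]. *)
Lemma levels_cost D : (0 < D)%N ->
  (\sum_(i < (up_log 9 D).+1) 3 ^ i)%:R <= 9 / 2 * Num.sqrt D%:R :> R.
Proof.
move=> D0; set lev := up_log 9 D.
have geom k : (2 * \sum_(i < k) 3 ^ i + 1 = 3 ^ k)%N.
  elim: k => [|k IH]; first by rewrite big_ord0.
  by rewrite big_ord_recr /= expnS mulnDr addnAC IH -mulSn.
have lev9 : (9 ^ lev <= 9 * D)%N.
  have [D1|D1] := leqP D 1.
    by rewrite /lev (_ : D = 1%N) ?up_log1 //; lia.
  have /andP[lt _] := @up_log_bounds 9 D isT D1.
  have : (0 < lev)%N by rewrite up_log_gt0 D1.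
  by move: lt; rewrite -/lev; case: (lev) => //= k; rewrite expnS; lia.
have pow : 3 ^+ lev <= 3 * Num.sqrt D%:R :> R.
  rewrite -(@ler_pXn2r _ 2) ?nnegrE ?exprn_ge0 ?mulr_ge0 ?sqrtr_ge0 //.
  rewrite exprMn sqr_sqrtr ?ler0n // -exprM mulnC exprM.
  have -> : (3 : R) ^+ 2 = 9%:R by ring.
  by rewrite -natrX -natrM ler_nat.
have := geom lev.+1; rewrite expnS => /(congr1 (fun m => m%:R : R)).
by rewrite natrD !natrM natrX; lra.
Qed.

(** With [t] the logarithm, [6 * n < 8 * 2 ^ t.+1 = 2 ^ (t + 4)], and [t + 4 <= 5 * t] because
    [t >= 1]. *)
Lemma trunc_log_pow n : (1 < n)%N -> (6 * n <= 2 ^ (5 * trunc_log 2 n))%N.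
Proof.
move=> n1; have /andP[_ lt] := @trunc_log_bounds 2 n isT (ltnW n1).
have t0 : (0 < trunc_log 2 n)%N by rewrite trunc_log_gt0.
set t := trunc_log 2 n in lt t0 *.
have : (2 ^ (t + 4) <= 2 ^ (5 * t))%N by rewrite leq_exp2l //; lia.
by rewrite expnD; move: lt; rewrite expnS; lia.
Qed.

Lemma trunc_log_le_ln n : (1 < n)%N ->
  (trunc_log 2 n)%:R * ln 2 <= ln n%:R :> R.
Proof.
move=> n1; have n0 : (0 < n)%N by exact: ltnW.
have /andP[le _] := @trunc_log_bounds 2 n isT n0.
rewrite mulr_natl -lnXn ?ltr0n // ler_ln ?posrE ?exprn_gt0 ?ltr0n //.
by rewrite -natrX ler_nat.
Qed.

End Estimates.

(** * Choice of parameters, success probability and query count *)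

Section Algorithm.
Variable R : realType.
Implicit Types eps : R.

(** A draw is free with probability at least [eps / (1 + eps)]; an integer bound on the inverse
    serves as exponent. *)
Definition inv_success eps : nat := (Num.truncn ((1 + eps) / eps)).+1.

Definition log_size (n : nat) : nat := (5 * trunc_log 2 n)%N.

Definition palette_of eps (D : nat) : nat := `|Num.ceil ((1 + eps) * D%:R)|%N.

(* The workspace only serves to make the state space at least as large as
   the palette, so that colors can be drawn from its basis labels. *)
Definition coloring_program eps n' :
    qprog R n'.+1 (palette_of eps n'.+1).+1 :=
  let q := inv_success eps in
  let l := log_size n'.+1 in
  with_max_degree (enum 'I_n'.+1) 0 (fun D =>
    color_all R _ D (palette_of eps D) (up_log 9 D) (3 * (l + q)) (q * l)
      (enum 'I_n'.+1) [ffun=> 0%N]).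

Definition coloring_algorithm eps n : qalgorithm R n :=
  match n with
  | 0 => QAlgorithm (Output R 0 [ffun=> 0%N])
  | n'.+1 => QAlgorithm (coloring_program eps n')
  end.

Lemma inv_success_ge eps : (1 + eps) / eps <= (inv_success eps)%:R.
Proof. exact/ltW/truncnS_gt. Qed.

Lemma inv_success_le eps : 0 < eps ->
  (inv_success eps)%:R <= (1 + 2 * eps) / eps.
Proof.
move=> eps0; have h0 : 0 <= (1 + eps) / eps by apply: divr_ge0; lra.
have /andP[le _] := truncn_itv h0.
have -> : (1 + 2 * eps) / eps = (1 + eps) / eps + 1 by field; rewrite gt_eqF.
by rewrite /inv_success -natr1 lerD2r.
Qed.

Lemma palette_of_ge eps D : 0 < eps ->
  (1 + eps) * D%:R <= (palette_of eps D)%:R.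
Proof.
move=> eps0; have h0 : 0 <= (1 + eps) * D%:R by apply: mulr_ge0 => //; lra.
rewrite /palette_of [leRHS]pmulrn gez0_abs ?ceil_ge //.
by rewrite ceil_ge0; lra.
Qed.

Lemma palette_of_mono eps D D' : 0 < eps ->
  (D <= D')%N -> (palette_of eps D <= palette_of eps D')%N.
Proof.
move=> eps0 DD; rewrite -(ler_nat int) /palette_of.
have h0 (E : nat) : 0 <= Num.ceil ((1 + eps) * E%:R).
  rewrite ceil_ge0; have : 0 <= (1 + eps) * E%:R by apply: mulr_ge0 => //; lra.
  by lra.
rewrite !natz !gez0_abs //; apply: ceil_le; apply: ler_wpM2l; first lra.
by rewrite ler_nat.
Qed.

Variables (n' : nat) (G : sgraph n'.+1) (nbr : 'I_n'.+1 -> seq 'I_n'.+1).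
Hypothesis nbrP : neighbor_ordering G nbr.
Hypothesis D0 : (0 < max_degree G)%N.
Local Notation n := n'.+1.
Local Notation D := (max_degree G).

Lemma max_degree_enum : maxn 0 (\max_(v <- enum 'I_n) degree G v) = D.
Proof. by rewrite max0n big_enum. Qed.

(** With [m = 6 * n], exhausted draws and overlooked conflicts each cost at most [1 / m] per vertex.
    Bernoulli turns [(1 - 1 / (3 * n)) ^+ n] into at least 2/3. *)
Lemma coloring_success eps : 0 < eps ->
  2 / 3 <= success_prob (coloring_algorithm eps n) G nbr
             (proper_coloring G (palette_of eps D)).
Proof.
move=> eps0; have Dn := max_degree_le G.
have n1 : (1 < n)%N by rewrite ltnS (leq_trans D0).
rewrite /success_prob /= prob_with_max_degree max_degree_enum.
set q := inv_success eps; set l := log_size n.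
set m := (6 * n)%N; have m0 : (0 < m)%N by [].
have ml : (m <= 2 ^ l)%N := trunc_log_pow n1.
have q0 : (0 < q)%N by []; have qr : 0 < q%:R :> R by rewrite ltr0n.
have mr : (m%:R^-1 : R) * (6 * n%:R) = 1.
  by rewrite -natrM mulVf // pnatr_eq0 -lt0n.
have n0 : 0 < n%:R :> R by rewrite ltr0n.
have n1' : 1 <= n%:R :> R by rewrite ler1n.
have m'0 : 0 <= m%:R^-1 :> R by rewrite invr_ge0.
pose h : R := 1 - 2 * m%:R^-1.
have h13 : 2 * m%:R^-1 * n%:R = 1 / 3 :> R by lra.
have m'le : 2 * m%:R^-1 <= 1 / 3 :> R.
  by rewrite -h13 ler_peMr // mulr_ge0.
have Kge := palette_of_ge D eps0.
have D0' : 0 < D%:R :> R by rewrite ltr0n.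
apply: (@le_trans _ _ (h ^+ size (enum 'I_n))).
  rewrite size_enum_ord; apply: le_trans (bernoulli_ge _ _); last by lra.
  by lra.
pose delta : R := (3 / 4) ^+ (3 * (l + q)).
apply: (@prob_color_all _ _ _ _ _ _ _ _ _ _ nbrP _ q%:R^-1 delta).
- apply: leq_trans (palette_of_mono eps0 (leqW Dn)) _.
  rewrite !card_prod !card_ord; apply: leq_trans (leqnSn _) _.
  by rewrite leq_pmull.
- by rewrite D0 leqW.
- exact: degree_le_max.
- exact: up_logP.
- rewrite -(ltr0n R); apply: lt_le_trans Kge; apply: mulr_gt0 => //; lra.
- by rewrite invr_gt0 qr invf_le1 // ler1n.
(* [K * (1 - 1 / q) >= (1 + eps) * D * (1 - 1 / q) >= D], the last step because
   [(1 + eps) / q <= eps]. *)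
- have qge := inv_success_ge eps; rewrite -/q ler_pdivrMr // in qge.
  set K := (palette_of eps D)%:R in Kge *.
  have qq : q%:R^-1 * q%:R = 1 :> R by rewrite mulVf // gt_eqF.
  have s0 : 0 < q%:R^-1 :> R by rewrite invr_gt0.
  have se : q%:R^-1 * (1 + eps) <= eps.
    by rewrite ler_pdivrMl // mulrC.
  have : 0 <= (K - (1 + eps) * D%:R) * (1 - q%:R^-1).
    apply: mulr_ge0; first by lra.
    by rewrite subr_ge0 invf_le1 // ler1n.
  have : 0 <= D%:R * (eps - q%:R^-1 * (1 + eps)) by apply: mulr_ge0; lra.
  by nra.
- by rewrite lexx /= /delta exprn_ile1 //; lra.
- by rewrite /h; lra.
- rewrite /h /delta invrK; have := overlook_bound R q ml m0.
  have := attempts_fail_bound R q0 ml m0; lra.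
- split=> [u|u u' _]; by rewrite mem_enum.
Qed.

(** There are [n] vertices, [q * l] draws each and [3 * (l + q)] repetitions per draw. Since
    [l + q <= 2 * l * q], the constant is [3 * 2 * 9 / 2 = 27]. *)
Lemma coloring_queries eps :
  (query_count (coloring_algorithm eps n) G nbr)%:R <=
    27 * (inv_success eps)%:R ^+ 2 * (log_size n)%:R ^+ 2 * n%:R *
      Num.sqrt D%:R :> R.
Proof.
have Dn := max_degree_le G; have n1 : (1 < n)%N by rewrite ltnS (leq_trans D0).
rewrite /query_count /= queries_with_max_degree max_degree_enum.
set q := inv_success eps; set l := log_size n; set lev := up_log 9 D.
have q1 : 1 <= q%:R :> R by rewrite ler1n.
have l1 : 1 <= l%:R :> R.
  by rewrite ler1n muln_gt0 /= trunc_log_gt0.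
set S := (\sum_(i < lev.+1) 3 ^ i)%N.
have Sle : S%:R <= 9 / 2 * Num.sqrt D%:R :> R := levels_cost R D0.
apply: (@le_trans _ _ (n * ((q * l) * ((3 * (l + q)) * S)))%:R).
  by rewrite ler_nat -[n in leqRHS]size_enum_ord; apply: queries_color_all.
have lq : l%:R + q%:R <= 2 * (l%:R * q%:R) :> R by nra.
clearbody q l S; rewrite !natrM natrD.
set x : R := Num.sqrt D%:R in Sle *; have x0 : 0 <= x by exact: sqrtr_ge0.
have -> : 27 * q%:R ^+ 2 * l%:R ^+ 2 * n%:R * x =
    n%:R * (q%:R * l%:R * (3 * (2 * (l%:R * q%:R)) * (9 / 2 * x))).
  by field.
do 2 (apply: ler_wpM2l; first by rewrite ?mulr_ge0).
apply: ler_pM => //; first by rewrite mulr_ge0 // addr_ge0.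
by apply: ler_wpM2l.
Qed.

End Algorithm.

Theorem theorem3 (R : realType) (eps_max : R) (heps_max : 0 < eps_max) :
  exists C : R, forall eps : R, 0 < eps -> eps <= eps_max ->
  exists A : forall n : nat, qalgorithm R n,
  forall (n : nat) (G : sgraph n) (nbr : 'I_n -> seq 'I_n),
    (0 < max_degree G)%N ->
    neighbor_ordering G nbr ->
    2%:R / 3%:R <= success_prob (A n) G nbr
                     (proper_coloring G (palette_size eps G)) /\
    (query_count (A n) G nbr)%:R
      <= C * (eps ^- 2 * n%:R * ln (n%:R) ^+ 2 * Num.sqrt (max_degree G)%:R).
Proof.
(* 27 comes from the query count, [(1 + 2 * eps_max) ^+ 2] from bounding [inv_success eps] uniformly
   in [eps], and [25 / ln 2 ^+ 2] from five binary logarithms, squared. *)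
exists (27 * (1 + 2 * eps_max) ^+ 2 * 25 / ln 2 ^+ 2) => eps eps0 epsm.
exists (coloring_algorithm eps) => -[|n'] G nbr D0 nbrP.
  by rewrite /max_degree big_ord0 in D0.
split; first exact: coloring_success.
apply: le_trans (coloring_queries nbr D0 eps) _.
set n := n'.+1; set x := Num.sqrt _.
have n1 : (1 < n)%N by rewrite ltnS (leq_trans D0) // max_degree_le.
have ln2 : 0 < ln 2 :> R by rewrite ln_gt0 // ltr1n.
have q2 : (inv_success eps)%:R ^+ 2 <= (1 + 2 * eps_max) ^+ 2 / eps ^+ 2 :> R.
  rewrite -expr_div_n; apply: lerXn2r; rewrite ?nnegrE //.
    by apply: divr_ge0; lra.
  apply: le_trans (inv_success_le eps0) _.
  by apply: ler_wpM2r; [rewrite invr_ge0 ltW | lra].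
have l2 : (log_size n)%:R ^+ 2 <= 25 * ln n%:R ^+ 2 / ln 2 ^+ 2 :> R.
  rewrite ler_pdivlMr ?exprn_gt0 // -exprMn.
  have -> : 25 * ln n%:R ^+ 2 = (5 * ln n%:R) ^+ 2 :> R by ring.
  have := trunc_log_le_ln R n1; rewrite /log_size natrM => tl.
  apply: lerXn2r; rewrite ?nnegrE; last by lra.
    by rewrite !mulr_ge0 // ltW.
  by rewrite mulr_ge0 // ln_ge0 // ler1n.
have -> : 27 * (1 + 2 * eps_max) ^+ 2 * 25 / ln 2 ^+ 2 *
    (eps ^- 2 * n%:R * ln n%:R ^+ 2 * x) =
  27 * ((1 + 2 * eps_max) ^+ 2 / eps ^+ 2) *
    (25 * ln n%:R ^+ 2 / ln 2 ^+ 2) * n%:R * x.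
  by field; rewrite ?gt_eqF.
have x0 : 0 <= x by exact: sqrtr_ge0.
do 2 apply: ler_wpM2r => //.
rewrite -[leLHS]mulrA -[leRHS]mulrA ler_wpM2l //.
by apply: ler_pM; rewrite ?exprn_ge0.
Qed.
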